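(* Consider the Diophantine equation $$L_{n_1}L_{n_2}L_{n_3}\cdots L_{n_k}-1 = L_m^2$$ in integers $m\geq 0$, $k\geq 1$, and $0\leq n_1\leq n_2 \leq \cdots \leq n_k$. For a given $m\ge 0$, it has a solution if and only if $m=1$. Moreover, the only nontrivial solution is given by $L_0-1 = L_1^2$.
   Context: $(L_n)_{n\ge 0}$ is the Lucas sequence: $L_0=2$, $L_1=1$, $L_n=L_{n-1}+L_{n-2}$ for $n\ge 2$. A solution is a tuple $(m,k,n_1,\dots,n_k)$; the indices $n_i$ need not be distinct. A solution is called nontrivial if either $k=1$, or $k\geq 2$ and $n_j\neq 1$ for every $j\in\{1,2,\ldots,k\}$. *)

(* Defs.v *)
From mathcomp Require Import all_boot all_order all_algebra.
Set Implicit Arguments.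
Unset Strict Implicit.
Unset Printing Implicit Defensive.
Import GRing.Theory.

Fixpoint lucas (n : nat) : nat :=
  match n with
  | 0 => 2
  | 1 => 1
  | (p.+1 as q).+1 => lucas q + lucas p
  end.

(* The equation is read in int, so that "- 1" is genuine subtraction. *)
Definition is_solution (m k : nat) (n : k.-tuple nat) : Prop :=
  [/\ 1 <= k,
      sorted leq n
    & (\prod_(i < k) (lucas (tnth n i))%:Z - 1 = (lucas m)%:Z ^+ 2)%R].

Definition nontrivial (k : nat) (n : k.-tuple nat) : Prop :=
  k = 1 \/ (2 <= k /\ forall j : 'I_k, tnth n j <> 1).

(* Main.v *)
Require Import Defs.
From mathcomp Require Import all_boot all_order all_algebra.
From mathcomp Require Import zify ring.

(** If [m] is even then [L_m ^ 2 + 1] is divisible by 5, but no Lucas number is.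
    If [m] is odd then [L_m ^ 2 + 1 = L_(2m) - 1].  Modulo [L_n] we have
    [L_(a + 2b) = ± L_a] as soon as [b = n] or [a + b = n], so [L_(2m)] is
    congruent to [± L_r] for some even [r <= n]; when [n >= 4] the numbers
    [L_r ± 1] lie strictly between 0 and [L_n], while 3 and 4 never divide a
    square plus one.  Hence every factor is [L_0 = 2] or [L_1 = 1], and a power
    of 2 of the form [x ^ 2 + 1] is at most 2. *)

Import GRing.Theory.

Lemma lucasSS n : lucas n.+2 = lucas n.+1 + lucas n.
Proof. by []. Qed.

Lemma nat_ind2 (P : nat -> Prop) :
  P 0 -> P 1 -> (forall n, P n -> P n.+1 -> P n.+2) -> forall n, P n.
Proof.
move=> P0 P1 IH n; suff [] : P n /\ P n.+1 by [].
by elim: n => [|n [Pn Pn1]]; split=> //; apply: IH.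
Qed.

Lemma lucas_gt0 n : 0 < lucas n.
Proof. by elim/nat_ind2: n => // n; rewrite lucasSS; lia. Qed.

Lemma lucas_gt1 n : n != 1 -> 1 < lucas n.
Proof.
by case: n => [|[|n]] // _; rewrite lucasSS; have := lucas_gt0 n; have := lucas_gt0 n.+1; lia.
Qed.

(** Monotonicity starts only at index 1, since [L_0 = 2] exceeds [L_1 = 1]. *)
Lemma leq_lucas m n : 0 < m -> m <= n -> lucas m <= lucas n.
Proof.
move=> m_gt0; elim: n => [|n IHn]; first by lia.
rewrite leq_eqVlt => /predU1P[-> // | lt_mn].
case: n => [|n] in IHn lt_mn *; first by lia.
by have := IHn lt_mn; rewrite lucasSS; lia.
Qed.

Lemma lucas_cassini n :
  ((lucas n.+1)%:Z ^+ 2 - (lucas n.+1)%:Z * (lucas n)%:Z - (lucas n)%:Z ^+ 2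
     = - 5 * (-1) ^+ n :> int)%R.
Proof.
elim: n => [//|n]; rewrite lucasSS PoszD (exprS _ n).
by set e : int := ((-1) ^+ n)%R; lia.
Qed.

(** The two formulas are carried through one induction because each step needs both; Cassini's
    identity absorbs the leftover quadratic terms. *)
Lemma lucas_double n :
  ((lucas n.*2)%:Z = (lucas n)%:Z ^+ 2 - 2 * (-1) ^+ n :> int)%R /\
  ((lucas n.*2.+1)%:Z = (lucas n.+1)%:Z * (lucas n)%:Z - (-1) ^+ n :> int)%R.
Proof.
elim: n => [//|n [IH0 IH1]].
have C := lucas_cassini n.
rewrite doubleS (lucasSS n.*2.+1) (lucasSS n.*2) (lucasSS n) !PoszD IH0 IH1 (exprS _ n).
by move: C; set e : int := ((-1) ^+ n)%R => C; split; lia.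
Qed.

(** For fixed [b] both sides satisfy the Lucas recurrence in [a], so the cases [a = 0] and [a = 1],
    which are the doubling formulas, suffice. *)
Lemma lucas_addn_double a b :
  ((lucas (a + b.*2))%:Z + (-1) ^+ b * (lucas a)%:Z
     = (lucas (a + b))%:Z * (lucas b)%:Z :> int)%R.
Proof.
have [D0 D1] := lucas_double b.
elim/nat_ind2: a => [||a IH0 IH1].
- by rewrite !add0n D0 /=; ring.
- by rewrite !add1n D1 /=; ring.
by rewrite !addSn !lucasSS !PoszD mulrDl -IH0 -IH1 !addSn; ring.
Qed.

Lemma lucas_fold a b n : (b == n) || (a + b == n) ->
  exists s : bool,
    ((lucas n)%:Z %| ((lucas (a + b.*2))%:Z - (-1) ^+ s * (lucas a)%:Z)%R)%Z.
Proof.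
move=> bn; exists (~~ odd b).
rewrite signrN mulNr opprK signr_odd lucas_addn_double.
by case/orP: bn => /eqP <-; [exact: dvdz_mull | exact: dvdz_mulr].
Qed.

Lemma lucas_mod n M : 0 < n -> exists r (s : bool),
  [/\ r <= n, odd r = odd M
    & ((lucas n)%:Z %| ((lucas M)%:Z - (-1) ^+ s * (lucas r)%:Z)%R)%Z].
Proof.
move=> n_gt0; elim/ltn_ind: M => M IH.
have [le_Mn | lt_nM] := leqP M n.
  by exists M, false; rewrite expr0 mul1r subrr dvdz0.
(* From [2n] on, [M] is shifted down by [2n]; strictly between [n] and [2n] it is reflected to
   [2n - M]. Both moves keep the parity. *)
have [le_nM | lt_Mn] := leqP n.*2 M.
  have [|r [s [le_rn par_r div_r]]] := IH (M - n.*2); first by lia.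
  have [|t] := @lucas_fold (M - n.*2) n n; first by rewrite eqxx.
  rewrite subnK // => div_t; exists r, (t (+) s); split=> //; first by lia.
  rewrite signr_addb; have := rpredD div_t (dvdz_mull ((-1) ^+ t)%R div_r).
  by congr (_ %| _)%Z; ring.
have [|t] := @lucas_fold (n.*2 - M) (M - n) n; first by lia.
have -> : n.*2 - M + (M - n).*2 = M by lia.
by move=> div_t; exists (n.*2 - M), t; split=> //; lia.
Qed.

(** Modulo 5 the polynomial [x^2 - x - 1] has the double root 3, and [L_1 = 3 L_0] there, so the
    sequence is geometric. *)
Lemma lucas_mod5S n : lucas n.+1 = 3 * lucas n %[mod 5].
Proof. by elim: n => [//|n IHn]; rewrite lucasSS; lia. Qed.

Lemma lucas_double_mod5 n : (lucas n.*2 %% 5 == 2) || (lucas n.*2 %% 5 == 3).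
Proof.
elim: n => [//|n]; rewrite doubleS.
by have := lucas_mod5S n.*2; have := lucas_mod5S n.*2.+1; lia.
Qed.

Lemma dvdn5_lucas n : (5 %| lucas n) = false.
Proof. by elim: n => [//|n]; have := lucas_mod5S n; lia. Qed.

Lemma dvdn5_lucas_sqr_add1 m : ~~ odd m -> 5 %| lucas m ^ 2 + 1.
Proof.
move=> m_even; rewrite -(even_halfK m_even) /dvdn -modnDml -modnXm.
by case/orP: (lucas_double_mod5 m./2) => /eqP ->.
Qed.

Lemma dvdn3_sqr_add1 x : (3 %| x ^ 2 + 1) = false.
Proof.
rewrite /dvdn -modnDml -modnXm.
by have := ltn_pmod x (isT : 0 < 3); case: (x %% 3) => [|[|[|]]].
Qed.

Lemma dvdn4_sqr_add1 x : (4 %| x ^ 2 + 1) = false.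
Proof.
rewrite /dvdn -modnDml -modnXm.
by have := ltn_pmod x (isT : 0 < 4); case: (x %% 4) => [|[|[|[|]]]].
Qed.

Lemma lucas_dvd_sqr_add1 m n : odd m -> lucas n %| lucas m ^ 2 + 1 -> n < 2.
Proof.
move=> m_odd; case: n => [|[|[|[|n]]]] //.
- by rewrite dvdn3_sqr_add1.
- by rewrite dvdn4_sqr_add1.
move: n.+4 (isT : 3 < n.+4) => {}n n_gt3 div_n.
have [r [s [le_rn par_r div_r]]] := @lucas_mod n m.*2 (ltnW (ltnW (ltnW n_gt3))).
have divM : ((lucas n)%:Z %| ((lucas m.*2)%:Z - 1)%R)%Z.
  rewrite (lucas_double m).1 -signr_odd m_odd expr1.
  have -> : ((lucas m)%:Z ^+ 2 - 2 * -1 - 1 = (lucas m ^ 2 + 1)%:Z :> int)%R.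
    by rewrite PoszD -mulnn PoszM; ring.
  exact: div_n.
have r_even : ~~ odd r by rewrite par_r odd_double.
have r_gt1 : 1 < lucas r by apply: lucas_gt1; case: eqP r_even => // ->.
(* The gap is [L_(n-2)], which exceeds 1 because [n - 2 >= 2]. *)
have n_gt : lucas n.-1 + 1 < lucas n.
  by case: (n) n_gt3 => [|[|[|[|p]]]] // _; rewrite (lucasSS p.+2) ltn_add2l lucas_gt1.
have div1 : ((lucas n)%:Z %| (1 - (-1) ^+ s * (lucas r)%:Z)%R)%Z.
  by have := rpredB div_r divM; congr (_ %| _)%Z; ring.
(* If [r = n], then [L_n] divides 1, which is absurd. *)
have [le_nr | r_lt] := leqP n r.
  have := rpredD div1 (dvdz_mull ((-1) ^+ s)%R (dvdzz (lucas n)%:Z)).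
  have -> : r = n by apply/eqP; rewrite eqn_leq le_rn.
  rewrite subrK dvdzE dvdn1 => /eqP.
  by move=> n1; move: n_gt; rewrite [lucas n]n1 addn1.
have r_small : lucas r <= lucas n.-1.
  (* Index 0 escapes monotonicity, so [L_0 = 2] is bounded through [L_3 = 4], using [n - 1 >= 3]. *)
  case: (posnP r) => [-> | r_gt0]; last by apply: leq_lucas; last by rewrite -ltnS (ltn_predK r_lt).
  by apply: (@leq_trans (lucas 3)) => //; apply: leq_lucas; last by rewrite -ltnS (ltn_predK r_lt).
suff : lucas n %| (if s then lucas r + 1 else lucas r - 1).
  by move=> /dvdn_leq; clear -n_gt r_gt1 r_small; case: s; lia.
by case: s div1 {div_r}; rewrite dvdzE ?expr1 ?expr0; congr (_ %| _); lia.
Qed.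

Lemma lucas_prod_sqr_add1 m k (n : k.-tuple nat) :
  \prod_(i < k) lucas (tnth n i) = lucas m ^ 2 + 1 ->
  m = 1 /\ forall i, tnth n i < 2.
Proof.
move=> prodE.
have dvd_prod i : lucas (tnth n i) %| lucas m ^ 2 + 1.
  by rewrite -prodE (bigD1 i) //= dvdn_mulr.
have m_odd : odd m.
  apply: contraT => /dvdn5_lucas_sqr_add1; rewrite -prodE.
  by rewrite Euclid_dvd_prod // big_orE => /existsP[i]; rewrite dvdn5_lucas.
have n_lt2 i : tnth n i < 2 := lucas_dvd_sqr_add1 _ _ m_odd (dvd_prod i).
split=> //.
have [c prod2] : exists c, \prod_(i < k) lucas (tnth n i) = 2 ^ c.
  elim/big_ind: _ => [|_ _ [a ->] [b ->]|i _]; first by exists 0.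
    by exists (a + b); rewrite expnD.
  by case: (tnth n i) (n_lt2 i) => [|[|]] // _; [exists 1 | exists 0].
have c_lt2 : c < 2.
  rewrite ltnNge; apply/negP => c_ge2; have := dvdn4_sqr_add1 (lucas m).
  by rewrite -prodE prod2 -(subnK c_ge2) expnD dvdn_mull.
(* If [m] were not 1, then [L_m >= 2] and [L_m^2 + 1 >= 5], too large for [2^c] with [c < 2]. *)
apply/eqP; apply: contraT => /lucas_gt1.
by move: prodE; rewrite prod2; case: c c_lt2 {prod2} => [|[|]] // _; nia.
Qed.

(** Moving the 1 across turns the integer equation into one over [nat], where the divisibility
    arguments apply. *)
Lemma is_solutionE m k (n : k.-tuple nat) : is_solution m n <->
  [/\ 1 <= k, sorted leq n & \prod_(i < k) lucas (tnth n i) = lucas m ^ 2 + 1].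
Proof.
rewrite /is_solution.
have -> : (\prod_(i < k) (lucas (tnth n i))%:Z = (\prod_(i < k) lucas (tnth n i))%N%:Z)%R.
  by elim/big_rec2: _ => // i x y _ ->.
split=> -[k_gt0 n_sorted prodE]; split=> //; move: prodE; move: (\prod_(i < k) _) => P; lia.
Qed.

Theorem theorem8 :
  (forall m : nat,
     (exists (k : nat) (n : k.-tuple nat), is_solution m n) <-> m = 1)
  /\
  (forall (m k : nat) (n : k.-tuple nat),
     (is_solution m n /\ nontrivial n) <->
     [/\ m = 1, k = 1 & tval n = [:: 0]]).
Proof.
have sol1 (n : 1.-tuple nat) : tval n = [:: 0] -> is_solution 1 n.
  by move=> nE; split; rewrite ?nE // big_ord1 (tnth_nth 0) nE.
split=> [m|m k n]; split.
- by case=> k [n /is_solutionE[_ _ /lucas_prod_sqr_add1[]]].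
- by move=> ->; exists 1, [tuple 0]; apply: sol1.
- case=> /is_solutionE[_ _ prodE] nontriv.
  have [m1 n_lt2] := lucas_prod_sqr_add1 _ _ _ prodE; rewrite {m}m1 in prodE *.
  case: nontriv => [k1 | [k_ge2 n_neq1]].
    subst k; split=> //; move: prodE; rewrite big_ord1.
    case: n n_lt2 => -[|x []] // n_size n_lt2; rewrite (tnth_nth 0) /=.
    by have := n_lt2 ord0; rewrite (tnth_nth 0) /=; case: x {n_lt2 n_size} => [|[]].
  (* All indices are below 2 and differ from 1, so every factor is [L_0 = 2]; but [2^k = 2]
     contradicts [k >= 2]. *)
  have pow2 : 2 ^ k = lucas 1 ^ 2 + 1.
    rewrite -prodE -[in LHS](card_ord k) -prod_nat_const; apply: eq_bigr => i _.
    by have := n_neq1 i; case: (tnth n i) (n_lt2 i) => [|[]].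
  by have := leq_pexp2l (isT : 0 < 2) k_ge2; rewrite pow2.
- by case=> -> k1; subst k => /sol1 n_sol; split; last by left.
Qed.
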